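(* Let $W\in\mathbb{R}^{n\times n}$ be symmetric positive definite and let $T\in\mathbb{R}^{n\times n}$ be symmetric, indefinite and nonsingular. Let $\lambda_{\max}$ be the largest eigenvalue of $W$, let $\mu_{\min}>0$ be the smallest absolute value of an eigenvalue of $T$, and let $\xi_{\max}$ be an eigenvalue of $T^{-1}W$ of largest absolute value. For $\alpha>0$ let $$G(W;\alpha)=\frac{1}{\alpha+1}\left(\mathrm{i}\alpha T^{-1}W+I\right),\qquad \sigma(\alpha)=\frac{\lambda_{\max}}{\alpha+\lambda_{\max}}\cdot\frac{\sqrt{\alpha^{2}+\mu_{\min}^{2}}}{\mu_{\min}},$$ let $\alpha^{*}=\mu_{\min}^{2}/\lambda_{\max}$, and let $$\mathcal{D}_I=\left(0,\frac{2\lambda_{\max}\mu_{\min}^{2}}{\lambda_{\max}^{2}-\mu_{\min}^{2}}\right),\qquad \mathcal{D}_W=\left(0,\frac{2}{\xi_{\max}^{2}-1}\right).$$ Then: (a) The parameter $\alpha_{W}^{*}=\xi_{\max}^{-2}$ minimizes the spectral radius $\rho(G(W;\alpha))$. Moreover $|\xi_{\max}|\le\lambda_{\max}/\mu_{\min}$, and therefore $$\rho(G(W;\alpha_{W}^{*}))=\frac{1}{\sqrt{\xi_{\max}^{-2}+1}}\le\frac{1}{\sqrt{\frac{\mu_{\min}^{2}}{\lambda_{\max}^{2}}+1}}=\frac{\lambda_{\max}}{\sqrt{\lambda_{\max}^{2}+\mu_{\min}^{2}}}=\sigma(\alpha^{*}).$$ (b) When $\lambda_{\max}\le 1$, $$\frac{2\lambda_{\max}\mu_{\min}^{2}}{\lambda_{\max}^{2}-\mu_{\min}^{2}}\le\frac{2}{\xi_{\max}^{2}-1},$$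 and thus $\mathcal{D}_I\subseteq\mathcal{D}_W$.
   Context: A real symmetric matrix is indefinite if it has at least one positive and at least one negative eigenvalue. $\rho$ denotes the spectral radius. For the system $(W+\mathrm{i}T)x=b$, the LHSS iteration is $(\alpha I+W)x^{(k+1/2)}=(\alpha I-\mathrm{i}T)x^{(k)}+b$, $Tx^{(k+1)}=\mathrm{i}Wx^{(k+1/2)}-\mathrm{i}b$; the spectral radius of its iteration matrix is bounded by $\sigma(\alpha)$, and $\alpha^{*}$ minimizes $\sigma$ over $\alpha>0$. The preconditioned LHSS iteration with preconditioner $V=W$ is obtained by replacing $I$ by $W$ in the LHSS iteration, and its iteration matrix is $G(W;\alpha)$. The interval $\mathcal{D}_I$ was introduced as the set of $\alpha$ with $\sigma(\alpha)<1$ in the case $\lambda_{\max}>\mu_{\min}$, and $\mathcal{D}_W$ as the range of $\alpha$ giving $\rho(G(W;\alpha))<1$ in the case $|\xi_{\max}|>1$. The interpretation given is that (a) indicates the preconditioned scheme with $V=W$ is more efficient than LHSS when each uses its own optimal parameter, and (b) indicates that the preconditioned scheme has the larger convergence domain when $\lambda_{\max}\le 1$.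
   Formalization: Part (b) is stated under the extra assumption |ξ_max| > 1, the case in which D_W was introduced; without it the inequality fails, e.g. W = diag(1/2, 1/10), T = diag(1, −1/5), where the bound of D_W is negative and that of D_I positive. *)

(* Defs.v *)
From HB Require Import structures.
From mathcomp Require Import all_boot all_order all_algebra.
From mathcomp Require Import complex.
From mathcomp Require Import boolp classical_sets set_interval reals.

Set Implicit Arguments.
Unset Strict Implicit.
Unset Printing Implicit Defensive.

Import Order.TTheory GRing.Theory Num.Theory.

Local Open Scope classical_set_scope.
Local Open Scope ring_scope.
Local Open Scope complex_scope.

Definition posdefmx (R : realType) (n : nat) (A : 'M[R]_n) : Prop :=
  forall x : 'cV[R]_n, x != 0 -> 0 < (x^T *m A *m x) 0 0.

Definition indefinitemx (R : realType) (n : nat) (A : 'M[R]_n) : Prop :=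
  (exists2 a : R, eigenvalue A a & 0 < a) /\
  (exists2 a : R, eigenvalue A a & a < 0).

Definition max_eigenvalue (R : realType) (n : nat) (A : 'M[R]_n) (l : R) : Prop :=
  eigenvalue A l /\ forall a : R, eigenvalue A a -> a <= l.

(* m is the absolute value of an eigenvalue, not itself an eigenvalue. *)
Definition min_abs_eigenvalue (R : realType) (n : nat) (A : 'M[R]_n) (m : R) : Prop :=
  (exists2 a : R, eigenvalue A a & `|a| = m) /\
  forall a : R, eigenvalue A a -> m <= `|a|.

(* x is a (signed) eigenvalue whose absolute value is largest.  Only real
   eigenvalues are compared; when T is symmetric and W is symmetric positive
   definite, all complex eigenvalues of T^-1 W are real. *)
Definition max_abs_eigenvalue (R : realType) (n : nat) (A : 'M[R]_n) (x : R) : Prop :=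
  eigenvalue A x /\ forall a : R, eigenvalue A a -> `|a| <= `|x|.

(* [Normc.normc] is the R-valued modulus on R[i]; the supremum is over a
   finite set, nonempty as soon as 0 < n. *)
Definition spectral_radius (R : realType) (n : nat) (A : 'M[R[i]]_n) : R :=
  sup [set Normc.normc z | z in [set z : R[i] | eigenvalue A z]].

Definition PLHSS_mx (R : realType) (n : nat) (W T : 'M[R]_n) (alpha : R) : 'M[R[i]]_n :=
  ((alpha + 1)^-1)%:C *:
    (('i * alpha%:C) *: map_mx (real_complex R) (invmx T *m W) + 1%:M).

Definition sigma (R : realType) (lmax mumin alpha : R) : R :=
  lmax / (alpha + lmax) * (Num.sqrt (alpha ^+ 2 + mumin ^+ 2) / mumin).

Definition alpha_star (R : realType) (lmax mumin : R) : R := mumin ^+ 2 / lmax.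

Definition alphaW_star (R : realType) (ximax : R) : R := ximax ^- 2.

Definition DI_bound (R : realType) (lmax mumin : R) : R :=
  2 * lmax * mumin ^+ 2 / (lmax ^+ 2 - mumin ^+ 2).

Definition DW_bound (R : realType) (ximax : R) : R := 2 / (ximax ^+ 2 - 1).

(* DI describes convergence when mumin < lmax, and DW when 1 < `|ximax|;
   otherwise the denominators are zero or negative.  Since
   `|ximax| <= lmax / mumin, the second case implies the first. *)
Definition DI (R : realType) (lmax mumin : R) : set R :=
  `]0, DI_bound lmax mumin[.

Definition DW (R : realType) (ximax : R) : set R := `]0, DW_bound ximax[.

(* Main.v *)
Require Import Defs.
From HB Require Import structures.
From mathcomp Require Import all_boot all_order all_algebra.
From mathcomp Require Import complex.
From mathcomp Require Import boolp classical_sets set_interval reals.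
From mathcomp Require Import ring lra.

(* The matrix T^-1 W has only real eigenvalues, because u W = z (u T) with W
   positive definite and T symmetric forces z to be real.  Hence the eigenvalues
   of G(W; alpha) are (1 + i alpha xi) / (alpha + 1) with xi a real eigenvalue of
   T^-1 W, and rho(G(W; alpha)) = sqrt (1 + alpha^2 ximax^2) / (alpha + 1).  The
   Cauchy-Schwarz inequality
   (1 + alpha)^2 <= (1 + alpha^2 ximax^2) (1 + ximax^-2)
   gives the minimum, attained at alpha = ximax^-2.  The bound on |ximax| follows
   from |u W| <= lmax |u| and mumin |u| <= |u T|. *)

Set Implicit Arguments.
Unset Strict Implicit.
Unset Printing Implicit Defensive.

Import Order.TTheory GRing.Theory Num.Theory.

Local Open Scope classical_set_scope.
Local Open Scope ring_scope.


(** * Symmetric and positive definite forms on row vectors *)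

Lemma symmetricmx_tr (R : fieldType) (n : nat) (S : 'M[R]_n) :
  S \is symmetricmx -> S^T = S.
Proof.
by move/is_hermitianmxP; rewrite expr0 scale1r (map_mx_id (fun=> erefl)).
Qed.

(** A one-by-one matrix equals its transpose. *)
Lemma mulmx_bilinC (R : fieldType) (n : nat) (S : 'M[R]_n) (x y : 'rV[R]_n) :
  S \is symmetricmx -> (x *m S *m y^T) 0 0 = (y *m S *m x^T) 0 0.
Proof.
move=> /symmetricmx_tr Ssym; transitivity ((x *m S *m y^T)^T 0 0).
  by rewrite [RHS]mxE.
by rewrite !trmx_mul trmxK Ssym mulmxA.
Qed.

(** Eigenvectors are rows here, while [posdefmx] quantifies over columns; this moves positivity to
    rows. *)
Lemma posdefmx_row (R : realType) (n : nat) (W : 'M[R]_n) (x : 'rV[R]_n) :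
  posdefmx W -> x != 0 -> 0 < (x *m W *m x^T) 0 0.
Proof.
move=> Wpos x0; have /Wpos : x^T != 0 by rewrite trmx_eq0.
by rewrite trmxK.
Qed.

Lemma posdefmx_row_ge0 (R : realType) (n : nat) (W : 'M[R]_n) (x : 'rV[R]_n) :
  posdefmx W -> 0 <= (x *m W *m x^T) 0 0.
Proof.
move=> Wpos; have [->|/(posdefmx_row Wpos)/ltW//] := eqVneq x 0.
by rewrite !mul0mx mxE.
Qed.

Lemma mulmx_tr_gt0 (R : realDomainType) (n : nat) (u : 'rV[R]_n) :
  u != 0 -> 0 < (u *m u^T) 0 0.
Proof.
move=> u0; rewrite mxE.
have [i ui0] : exists i, u 0 i != 0.
  apply/existsP; rewrite -negb_forall; apply: contra u0 => /forallP ui0.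
  by apply/eqP/rowP => i; rewrite mxE; apply/eqP.
rewrite (bigD1 i)//= ltr_pwDl//.
  by rewrite mxE -expr2 lt_def sqrf_eq0 ui0 sqr_ge0.
by apply: sumr_ge0 => j _; rewrite mxE -expr2 sqr_ge0.
Qed.

Lemma posdefmx_eigenvalue_gt0 (R : realType) (n : nat) (W : 'M[R]_n) (a : R) :
  posdefmx W -> eigenvalue W a -> 0 < a.
Proof.
move=> Wpos /eigenvalueP[v vW v0]; have := posdefmx_row Wpos v0.
by rewrite vW -scalemxAl mxE pmulr_lgt0// mulmx_tr_gt0.
Qed.

Lemma unitmx_mul_eq0 (R : comUnitRingType) (m n : nat) (T : 'M[R]_n) (v : 'M[R]_(m, n)) :
  T \in unitmx -> v *m T = 0 -> v = 0.
Proof. by move=> Tu vT; rewrite -(mulmxK Tu v) vT mul0mx. Qed.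

Lemma unitmx_eigenvalue_neq0 (F : fieldType) (n : nat) (T : 'M[F]_n) (a : F) :
  T \in unitmx -> eigenvalue T a -> a != 0.
Proof.
move=> Tu /eigenvalueP[v vT v0]; apply: contra_neq v0 => a0.
by apply: (unitmx_mul_eq0 Tu); rewrite vT a0 scale0r.
Qed.

Lemma posdefmx_unit (R : realType) (n : nat) (W : 'M[R]_n) :
  posdefmx W -> W \in unitmx.
Proof.
move=> Wpos; rewrite -row_free_unit -kermx_eq0.
apply/eqP/row_matrixP => i; rewrite row0; apply/eqP/negPn/negP.
move=> /(posdefmx_row Wpos).
by rewrite -row_mul mulmx_ker row0 mul0mx mxE ltxx.
Qed.

(** * Reality of the spectrum of [invmx T *m W] *)

Lemma map_Re_mul_real (R : rcfType) (m n p : nat) (u : 'M[R[i]]_(m, n)) (M : 'M[R]_(n, p)) :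
  map_mx (@complex.Re R) (u *m map_mx (real_complex R) M) =
  map_mx (@complex.Re R) u *m M.
Proof.
apply/matrixP => i j; rewrite !mxE (raddf_sum (@complex.Re R : Rcomplex R -> R)).
by apply: eq_bigr => k _; rewrite !mxE; case: (u i k) => a b /=; ring.
Qed.

Lemma map_Im_mul_real (R : rcfType) (m n p : nat) (u : 'M[R[i]]_(m, n)) (M : 'M[R]_(n, p)) :
  map_mx (@complex.Im R) (u *m map_mx (real_complex R) M) =
  map_mx (@complex.Im R) u *m M.
Proof.
apply/matrixP => i j; rewrite !mxE (raddf_sum (@complex.Im R : Rcomplex R -> R)).
by apply: eq_bigr => k _; rewrite !mxE; case: (u i k) => a b /=; ring.
Qed.

(* The hypotheses are the real and imaginary parts of
   [(x + i y) W = (a + i b) (x + i y) T]. *)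
Lemma pencil_eigenvalue_real (R : realType) (n : nat) (W T : 'M[R]_n) (x y : 'rV[R]_n)
    (a b : R) :
  W \is symmetricmx -> posdefmx W -> T \is symmetricmx ->
  (x != 0) || (y != 0) ->
  x *m W = a *: (x *m T) - b *: (y *m T) ->
  y *m W = a *: (y *m T) + b *: (x *m T) -> b = 0.
Proof.
move=> Wsym Wpos Tsym xy0 xW yW.
pose q (M : 'M[R]_n) (u v : 'rV[R]_n) := (u *m M *m v^T) 0 0.
have qx v : q W x v = a * q T x v - b * q T y v.
  by rewrite /q xW mulmxBl -!scalemxAl !mxE.
have qy v : q W y v = a * q T y v + b * q T x v.
  by rewrite /q yW mulmxDl -!scalemxAl !mxE.
have TC : q T x y = q T y x by exact: mulmx_bilinC.
have : q W x y = q W y x by exact: mulmx_bilinC.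
rewrite qx qy TC => bt.
(* By symmetry of both forms, [bt] amounts to [b * (q T x x + q T y y) = 0]. The positive sum below
   equals [a * (q T x x + q T y y)], so [b] cannot be nonzero. *)
have : 0 < q W x x + q W y y.
  by case/orP: xy0 => ?; [apply: ltr_wpDr|apply: ltr_wpDl];
     rewrite ?posdefmx_row ?posdefmx_row_ge0.
rewrite qx qy TC; apply: contraTeq => b0.
suff -> : q T y y = - q T x x by rewrite -leNgt; lra.
by apply: (mulfI b0); lra.
Qed.

(** For a left eigenvector [v], the row [u = v T^-1] satisfies [u W = z (u T)]; its real and
    imaginary parts satisfy the hypotheses of [pencil_eigenvalue_real]. *)
Lemma complex_eigenvalue_real (R : realType) (n : nat) (W T : 'M[R]_n) (z : R[i]) :
  W \is symmetricmx -> posdefmx W -> T \is symmetricmx -> T \in unitmx ->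
  eigenvalue (map_mx (real_complex R) (invmx T *m W)) z ->
  exists2 a : R, z = real_complex R a & eigenvalue (invmx T *m W) a.
Proof.
move=> Wsym Wpos Tsym Tu ez.
have [v vz v0] := eigenvalueP ez.
pose RC := map_mx (real_complex R).
pose u := v *m RC _ _ (invmx T).
have uT : u *m RC _ _ T = v by rewrite /u -mulmxA -map_mxM mulVmx// map_mx1 mulmx1.
have uW : u *m RC _ _ W = z *: (u *m RC _ _ T).
  by rewrite uT -vz /u -mulmxA -map_mxM.
clearbody u; case: z ez {vz} uW => a b ez uW.
suff b0 : b = 0.
  rewrite b0 in ez; exists a; first by rewrite b0.
  by rewrite -(eigenvalue_map (real_complex R)).
have zRe (w : 'rV[R[i]]_n) : map_mx (@complex.Re R) ((a +i* b)%C *: w) =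
    a *: map_mx (@complex.Re R) w - b *: map_mx (@complex.Im R) w.
  by apply/rowP => j; rewrite !mxE; case: (w 0 j).
have zIm (w : 'rV[R[i]]_n) : map_mx (@complex.Im R) ((a +i* b)%C *: w) =
    a *: map_mx (@complex.Im R) w + b *: map_mx (@complex.Re R) w.
  by apply/rowP => j; rewrite !mxE; case: (w 0 j).
apply: (pencil_eigenvalue_real (x := map_mx (@complex.Re R) u)
  (y := map_mx (@complex.Im R) u) Wsym Wpos Tsym).
- rewrite -negb_and; apply: contra v0 => /andP[/eqP/rowP x0 /eqP/rowP y0].
  rewrite -uT (_ : u = 0) ?mul0mx//; apply/rowP => j.
  by move: (x0 j) (y0 j); rewrite !mxE; case: (u 0 j) => /= ? ? -> ->.
- by rewrite -map_Re_mul_real uW zRe map_Re_mul_real map_Im_mul_real.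
- by rewrite -map_Im_mul_real uW zIm map_Re_mul_real map_Im_mul_real.
Qed.

(** * Norm bounds from the spectral theorem, and the bound on eigenvalues of [invmx T *m W] *)

(* The [w i] are the squared coordinates of [u] in an orthonormal eigenbasis of
   [S], taken over the complex numbers. *)
Lemma symmetricmx_spectral_weights (R : realType) (n : nat) (S : 'M[R]_n) (u : 'rV[R]_n) :
  S \is symmetricmx ->
  exists w a : 'I_n -> R,
    [/\ forall i, 0 <= w i, forall i, eigenvalue S (a i),
        (u *m u^T) 0 0 = \sum_i w i &
        (u *m S *m (u *m S)^T) 0 0 = \sum_i w i * a i ^+ 2].
Proof.
move=> Ssym.
pose RC := real_complex R.
have realRC m p (M : 'M[R]_(m, p)) : map_mx RC M \is a mxOver Num.real.
  by apply/mxOverP => i j; rewrite mxE; apply/complex_realP; exists (M i j).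
have conjRC m p (M : 'M[R]_(m, p)) : map_mx Num.conj (map_mx RC M) = map_mx RC M.
  exact: realmxC.
pose A := map_mx RC S.
have Aherm : A \is hermitianmx _ false Num.conj.
  apply: realsym_hermsym; last exact: realRC.
  apply/is_hermitianmxP; rewrite expr0 scale1r (map_mx_id (fun=> erefl)).
  by rewrite /A map_trmx symmetricmx_tr.
pose P := spectralmx A; pose D := spectral_diag A.
have Pu : P \is unitarymx by exact: spectral_unitarymx.
have Punit := unitarymx_unit Pu.
have AE : A = invmx P *m diag_mx D *m P.
  by apply/orthomx_spectralP; exact: hermitian_normalmx.
have Dreal : D \is a mxOver Num.real by exact: hermitian_spectral_diag_real.
pose uC := map_mx RC u; pose y := uC *m invmx P.
(* A unitary [P] preserves the Hermitian norm. *)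
have normP (v : 'rV[R[i]]_n) :
    v *m P *m map_mx Num.conj (v *m P)^T = v *m map_mx Num.conj v^T.
  by rewrite trmx_mul map_mxM !mulmxA mulmxtVK.
have uE : uC = y *m P by rewrite mulmxKV.
have uAE : uC *m A = y *m diag_mx D *m P by rewrite AE /y !mulmxA.
have sqE (v : 'rV[R[i]]_n) : (v *m map_mx Num.conj v^T) 0 0 = \sum_i `|v 0 i| ^+ 2.
  by rewrite mxE; apply: eq_bigr => i _; rewrite !mxE normCK.
have RC_norm (x : 'rV[R]_n) :
    RC ((x *m x^T) 0 0) = (map_mx RC x *m map_mx Num.conj (map_mx RC x)^T) 0 0.
  by rewrite map_trmx conjRC -map_mxM [RHS]mxE.
have sqC (z : R[i]) : `|z| ^+ 2 = RC (Normc.normc z ^+ 2).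
  exact: (esym (rmorphXn (real_complex R) 2 _)).
(* The diagonal [D] is real because [A] is Hermitian, so taking real parts loses nothing. *)
exists (fun i => Normc.normc (y 0 i) ^+ 2), (fun i => complex.Re (D 0 i)).
have DE i : D 0 i = RC (complex.Re (D 0 i)).
  by rewrite /RC RRe_real//; exact: (mxOverP Dreal).
split => [i|i||]; first exact: sqr_ge0.
- rewrite -(eigenvalue_map RC) [X in eigenvalue _ X](_ : _ = D 0 i); last exact/esym/DE.
  (* From [P A = D P], row [i] of [P] is a left eigenvector; it is nonzero since [P] is
     invertible. *)
  apply/eigenvalueP; exists (row i P).
    rewrite -/A AE -row_mul !mulmxA mulmxV// mul1mx.
    by rewrite row_mul row_diag_mx -scalemxAl -rowE.
  apply: contraTneq Punit => Pi0; apply/negP => Punit.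
  have /eqP := congr1 (mulmx^~ (invmx P)) Pi0.
  rewrite -row_mul mulmxV// mul0mx => /eqP/rowP/(_ i)/eqP.
  by rewrite !mxE eqxx oner_eq0.
- apply: (@complexI R); rewrite -/RC RC_norm -/uC uE normP sqE /RC rmorph_sum.
  by apply: eq_bigr => i _; exact: sqC.
- apply: (@complexI R); rewrite -/RC RC_norm map_mxM -/uC -/A uAE normP sqE /RC rmorph_sum.
  apply: eq_bigr => i _; rewrite mul_mx_diag mxE normrM exprMn sqC rmorphM/=; congr (_ * _).
  rewrite real_normK; last exact: (mxOverP Dreal).
  by rewrite [in LHS]DE rmorphXn.
Qed.

(** Both squared norms are sums with the same nonnegative weights, so they compare term by term. *)
Lemma symmetricmx_norm_le (R : realType) (n : nat) (S : 'M[R]_n) (c : R) (u : 'rV[R]_n) :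
  S \is symmetricmx -> (forall a, eigenvalue S a -> `|a| <= c) ->
  (u *m S *m (u *m S)^T) 0 0 <= c ^+ 2 * (u *m u^T) 0 0.
Proof.
move=> Ssym Sc; have [w [a [w0 Sa -> ->]]] := symmetricmx_spectral_weights u Ssym.
rewrite mulr_sumr; apply: ler_sum => i _; rewrite mulrC ler_wpM2r//.
have := Sc _ (Sa i); rewrite -real_normK ?num_real// => ac.
(* Here [0 <= c] comes from [c] bounding an absolute value. *)
by rewrite lerXn2r// nnegrE ?normr_ge0// (le_trans _ ac).
Qed.

Lemma symmetricmx_norm_ge (R : realType) (n : nat) (S : 'M[R]_n) (c : R) (u : 'rV[R]_n) :
  0 <= c -> S \is symmetricmx -> (forall a, eigenvalue S a -> c <= `|a|) ->
  c ^+ 2 * (u *m u^T) 0 0 <= (u *m S *m (u *m S)^T) 0 0.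
Proof.
move=> c0 Ssym Sc; have [w [a [w0 Sa -> ->]]] := symmetricmx_spectral_weights u Ssym.
rewrite mulr_sumr; apply: ler_sum => i _; rewrite mulrC ler_wpM2l//.
rewrite -[a i ^+ 2]real_normK ?num_real//.
by rewrite lerXn2r// ?nnegrE ?normr_ge0// Sc.
Qed.

(* A left eigenvector [v] of [T^-1 W] gives [u := v T^-1] with [u W = x (u T)],
   and [m |u| <= |u T|], [|u W| <= l |u|]. *)
Lemma invmx_mul_eigenvalue_le (R : realType) (n : nat) (W T : 'M[R]_n) (l m x : R) :
  W \is symmetricmx -> T \is symmetricmx -> T \in unitmx -> 0 < m ->
  (forall a, eigenvalue W a -> `|a| <= l) -> (forall a, eigenvalue T a -> m <= `|a|) ->
  0 <= l -> eigenvalue (invmx T *m W) x -> `|x| <= l / m.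
Proof.
move=> Wsym Tsym Tu m0 Wl Tm l0 /eigenvalueP[v vx v0].
pose u := v *m invmx T.
have uT : u *m T = v by rewrite mulmxKV.
have uW : u *m W = x *: (u *m T) by rewrite uT -vx mulmxA.
have u0 : u != 0 by apply: contra_neq v0 => u0; rewrite -uT u0 mul0mx.
have uu := mulmx_tr_gt0 u0.
have := symmetricmx_norm_le u Wsym Wl.
have := symmetricmx_norm_ge u (ltW m0) Tsym Tm.
rewrite uW; set w := u *m T => mw.
rewrite linearZ/= -scalemxAl -scalemxAr scalerA mxE -expr2 => xw.
(* Squaring and multiplying by [|u|^2 > 0] leaves [x^2 m^2 |u|^2 <= l^2 |u|^2], which passes through
   [x^2 |u T|^2]. *)
rewrite ler_pdivlMr// -ler_sqr ?nnegrE ?mulr_ge0 ?normr_ge0 ?(ltW m0)//.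
rewrite exprMn real_normK ?num_real// -(ler_pM2r uu).
by apply: le_trans xw; rewrite -mulrA ler_wpM2l// sqr_ge0.
Qed.

(** * Spectrum and spectral radius of the iteration matrix *)

Lemma PLHSS_eigenvalue (R : realType) (n : nat) (W T : 'M[R]_n) (alpha x : R) :
  eigenvalue (invmx T *m W) x ->
  eigenvalue (PLHSS_mx W T alpha) (((alpha + 1)^-1)%:C * (1 +i* (alpha * x)))%C.
Proof.
rewrite -(eigenvalue_map (real_complex R)) => /eigenvalueP[v vx v0].
apply/eigenvalueP; exists v => //; rewrite /PLHSS_mx -scalemxAr mulmxDr mulmx1.
rewrite -scalemxAr vx scalerA -[X in _ *: (_ + X)]scale1r -scalerDl scalerA.
congr (_ * _ *: _); apply/eqP; rewrite eq_complex/=.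
by apply/andP; split; apply/eqP; ring.
Qed.

(** For [alpha > 0] the affine relation inverts to [T^-1 W = d^-1 (c G - I)] with [c = alpha + 1]
    and [d = i alpha], so an eigenvector of [G] is one of [T^-1 W], whose eigenvalues are real. *)
Lemma PLHSS_eigenvalue_inv (R : realType) (n : nat) (W T : 'M[R]_n) (alpha : R) (z : R[i]) :
  W \is symmetricmx -> posdefmx W -> T \is symmetricmx -> T \in unitmx ->
  0 < alpha -> eigenvalue (PLHSS_mx W T alpha) z ->
  exists2 x : R, eigenvalue (invmx T *m W) x &
    z = (((alpha + 1)^-1)%:C * (1 +i* (alpha * x)))%C.
Proof.
move=> Wsym Wpos Tsym Tu alpha0 /eigenvalueP[v vz v0].
set A := map_mx (real_complex R) (invmx T *m W) in vz.
pose c := ((alpha + 1)%:C)%C : R[i]; pose d := ('i * alpha%:C)%C : R[i].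
have c0 : c != 0 by rewrite (fmorph_eq0 (real_complex R)) gt_eqF// addr_gt0.
have d0 : d != 0.
  by rewrite /d eq_complex/= negb_and orbC mul0r mul1r add0r gt_eqF.
have vA : v *m A = (d^-1 * (c * z - 1)) *: v.
  rewrite -scalerA scalerBl scale1r -scalerA -vz /PLHSS_mx -/A.
  rewrite -scalemxAr scalerA fmorphV mulfV// scale1r mulmxDr mulmx1 addrK.
  by rewrite -scalemxAr scalerA mulVf// scale1r.
have /complex_eigenvalue_real : eigenvalue A (d^-1 * (c * z - 1)).
  by apply/eigenvalueP; exists v.
case=> // x zx ex; exists x => //.
have cz : c * z = 1 + d * (x%:C)%C by rewrite -zx mulrA mulfV// mul1r addrC subrK.
rewrite fmorphV; apply: (mulfI c0); rewrite cz mulrA mulfV// mul1r.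
by apply/eqP; rewrite eq_complex/=; apply/andP; split; apply/eqP; ring.
Qed.

Lemma PLHSS_eigenvalue_normc (R : realType) (alpha x : R) :
  0 < alpha ->
  Normc.normc (((alpha + 1)^-1)%:C * (1 +i* (alpha * x)))%C =
  Num.sqrt (1 + alpha ^+ 2 * x ^+ 2) / (alpha + 1).
Proof.
move=> alpha0; rewrite Normc.normcM/= expr0n addr0 sqrtr_sqr ger0_norm; last first.
  by rewrite invr_ge0 addr_ge0// ltW.
by rewrite expr1n exprMn mulrC.
Qed.

(** The modulus of an eigenvalue of [G] grows with [|xi|], so the supremum is attained at [x]. *)
Lemma spectral_radius_PLHSS (R : realType) (n : nat) (W T : 'M[R]_n) (alpha x : R) :
  W \is symmetricmx -> posdefmx W -> T \is symmetricmx -> T \in unitmx ->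
  max_abs_eigenvalue (invmx T *m W) x -> 0 < alpha ->
  spectral_radius (PLHSS_mx W T alpha) =
  Num.sqrt (1 + alpha ^+ 2 * x ^+ 2) / (alpha + 1).
Proof.
move=> Wsym Wpos Tsym Tu [ex xmax] alpha0; set r := RHS; rewrite /spectral_radius; set E := [set _ | _ in _].
have Er : E r.
  by exists (((alpha + 1)^-1)%:C * (1 +i* (alpha * x)))%C;
    [exact: PLHSS_eigenvalue|exact: PLHSS_eigenvalue_normc].
have ubE : ubound E r.
  move=> _ [y /(PLHSS_eigenvalue_inv Wsym Wpos Tsym Tu alpha0)[b eb ->] <-].
  rewrite PLHSS_eigenvalue_normc// ler_wpM2r ?invr_ge0 ?addr_ge0 ?(ltW alpha0)//.
  rewrite ler_wsqrtr// lerD2l ler_wpM2l ?sqr_ge0//.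
  rewrite -[b ^+ 2]real_normK ?num_real// -[x ^+ 2]real_normK ?num_real//.
  by rewrite lerXn2r ?nnegrE ?normr_ge0 ?xmax.
apply/le_anti/andP; split; first by apply: ge_sup ubE; exists r.
by apply: ub_le_sup Er; exists r.
Qed.

(** * Scalar identities and inequalities *)

Lemma PLHSS_factor_ge (R : rcfType) (a x : R) : 0 < a -> x != 0 ->
  1 / Num.sqrt (x ^- 2 + 1) <= Num.sqrt (1 + a ^+ 2 * x ^+ 2) / (a + 1).
Proof.
move=> a0 x0; have x2 : 0 < x ^+ 2 by rewrite exprn_even_gt0.
have y2 : 0 < x ^- 2 by rewrite invr_gt0.
have s1 : 0 < x ^- 2 + 1 by rewrite addr_gt0.
have s2 : 0 <= 1 + a ^+ 2 * x ^+ 2 by rewrite addr_ge0// mulr_ge0 ?sqr_ge0.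
rewrite ler_pdivrMr ?sqrtr_gt0// mulrAC ler_pdivlMr ?addr_gt0// mul1r.
rewrite -sqrtrM// -[leLHS]gtr0_norm ?addr_gt0// -sqrtr_sqr ler_wsqrtr//.
(* The defect in the Cauchy-Schwarz inequality is this square, which vanishes exactly at
   [a = x^-2]. *)
rewrite -subr_ge0 (_ : _ - _ = (a * x - x^-1) ^+ 2) ?sqr_ge0//.
by field.
Qed.

Lemma PLHSS_factor_star (R : rcfType) (x : R) : x != 0 ->
  Num.sqrt (1 + (x ^- 2) ^+ 2 * x ^+ 2) / (x ^- 2 + 1) = 1 / Num.sqrt (x ^- 2 + 1).
Proof.
move=> x0; have y2 : 0 < x ^- 2 by rewrite invr_gt0 exprn_even_gt0.
have s1 : 0 < x ^- 2 + 1 by rewrite addr_gt0.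
rewrite (_ : 1 + _ = x ^- 2 + 1); last by field.
rewrite -[X in _ / X = _](sqr_sqrtr (ltW s1)).
have : Num.sqrt (x ^- 2 + 1) != 0 by rewrite sqrtr_eq0 -ltNge.
by move: (Num.sqrt _) => s s0; field.
Qed.

Lemma inv_sqrt_ratio (R : rcfType) (l m : R) : 0 < l ->
  1 / Num.sqrt (m ^+ 2 / l ^+ 2 + 1) = l / Num.sqrt (l ^+ 2 + m ^+ 2).
Proof.
move=> l0; have s0 : 0 < l ^+ 2 + m ^+ 2 by rewrite ltr_pwDl ?sqr_ge0 ?exprn_gt0.
have -> : m ^+ 2 / l ^+ 2 + 1 = (l ^+ 2 + m ^+ 2) * (l^-1) ^+ 2.
  by field; rewrite gt_eqF.
rewrite sqrtrM ?ltW// sqrtr_sqr gtr0_norm ?invr_gt0//.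
have : Num.sqrt (l ^+ 2 + m ^+ 2) != 0 by rewrite sqrtr_eq0 -ltNge.
by move: (Num.sqrt _) => s s1; field; rewrite s1 gt_eqF.
Qed.

Lemma sigma_alpha_star (R : realType) (l m : R) : 0 < l -> 0 < m ->
  l / Num.sqrt (l ^+ 2 + m ^+ 2) = sigma l m (alpha_star l m).
Proof.
move=> l0 m0; rewrite /sigma /alpha_star.
have s0 : 0 < l ^+ 2 + m ^+ 2 by rewrite addr_gt0 ?exprn_gt0.
(* Both factors of [sigma] at [alpha_star] are expressed through [l^2 + m^2], so that one square
   root cancels. *)
have -> : (m ^+ 2 / l) ^+ 2 + m ^+ 2 = (l ^+ 2 + m ^+ 2) * (m / l) ^+ 2.
  by field; rewrite gt_eqF.
rewrite sqrtrM ?ltW// sqrtr_sqr gtr0_norm ?divr_gt0//.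
have -> : m ^+ 2 / l + l = (l ^+ 2 + m ^+ 2) / l by field; rewrite gt_eqF.
rewrite -[X in _ = _ / (X / _) * _](sqr_sqrtr (ltW s0)).
have : Num.sqrt (l ^+ 2 + m ^+ 2) != 0 by rewrite sqrtr_eq0 -ltNge.
by move: (Num.sqrt _) => s s1; field; rewrite s1 !gt_eqF.
Qed.

Lemma DI_bound_le (R : realType) (l m x : R) :
  0 < l -> 0 < m -> 1 < `|x| -> `|x| <= l / m -> l <= 1 ->
  DI_bound l m <= DW_bound x.
Proof.
move=> l0 m0 x1 xlm l1; rewrite /DI_bound /DW_bound.
have x2 : 1 < x ^+ 2 by rewrite -real_normK ?num_real// exprn_egt1.
have xm : x ^+ 2 * m ^+ 2 <= l ^+ 2.
  rewrite -ler_pdivlMr ?exprn_gt0// -expr_div_n -real_normK ?num_real//.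
  by rewrite lerXn2r ?nnegrE// (le_trans _ xlm).
have m2 : 0 < m ^+ 2 by rewrite exprn_gt0.
(* [1 < |x|] gives [m^2 < x^2 m^2 <= l^2], so both denominators are positive and can be cleared. *)
have lm : 0 < l ^+ 2 - m ^+ 2.
  by rewrite subr_gt0 (lt_le_trans _ xm)// ltr_pMl.
rewrite ler_pdivrMr// [leRHS]mulrAC ler_pdivlMr ?subr_gt0//.
have -> : 2 * l * m ^+ 2 * (x ^+ 2 - 1) =
    2 * (l * (x ^+ 2 * m ^+ 2 - m ^+ 2)) by ring.
(* The middle term drops the factor [l <= 1]; then [x^2 m^2 <= l^2] finishes. *)
rewrite ler_pM2l//; apply: (@le_trans _ _ (x ^+ 2 * m ^+ 2 - m ^+ 2)); last first.
  by rewrite lerD2r.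
by rewrite ler_piMl// subr_ge0 ler_peMl ?ltW.
Qed.

(** * Assembly of (a) and (b) *)

Theorem mainTheorem6 (R : realType) (n : nat) (W T : 'M[R]_n)
    (lmax mumin ximax : R)
    (Wsym : W \is symmetricmx) (Wpos : posdefmx W)
    (Tsym : T \is symmetricmx) (Tindef : indefinitemx T) (Tunit : T \in unitmx)
    (lmaxP : max_eigenvalue W lmax)
    (muminP : min_abs_eigenvalue T mumin)
    (ximaxP : max_abs_eigenvalue (invmx T *m W) ximax) :
  [/\ 0 < alphaW_star ximax,
      forall alpha : R, 0 < alpha ->
        spectral_radius (PLHSS_mx W T (alphaW_star ximax))
          <= spectral_radius (PLHSS_mx W T alpha),
      `|ximax| <= lmax / mumin &
      [/\ spectral_radius (PLHSS_mx W T (alphaW_star ximax))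
            = 1 / Num.sqrt (ximax ^- 2 + 1),
          1 / Num.sqrt (ximax ^- 2 + 1)
            <= 1 / Num.sqrt (mumin ^+ 2 / lmax ^+ 2 + 1),
          1 / Num.sqrt (mumin ^+ 2 / lmax ^+ 2 + 1)
            = lmax / Num.sqrt (lmax ^+ 2 + mumin ^+ 2) &
          lmax / Num.sqrt (lmax ^+ 2 + mumin ^+ 2)
            = sigma lmax mumin (alpha_star lmax mumin)]]
  /\
  (1 < `|ximax| -> lmax <= 1 ->
     DI_bound lmax mumin <= DW_bound ximax /\
     DI lmax mumin `<=` DW ximax).
Proof.
have [el lmax_ub] := lmaxP; have [[t et tm] mumin_lb] := muminP.
have [ex _] := ximaxP.
have l0 : 0 < lmax by exact: posdefmx_eigenvalue_gt0 el.
have m0 : 0 < mumin by rewrite -tm normr_gt0 (unitmx_eigenvalue_neq0 Tunit et).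
(* [T^-1 W] is a product of invertible matrices, so 0 is not an eigenvalue. *)
have x0 : ximax != 0.
  apply: unitmx_eigenvalue_neq0 ex.
  by rewrite unitmx_mul unitmx_inv Tunit posdefmx_unit.
have xlm : `|ximax| <= lmax / mumin.
  apply: invmx_mul_eigenvalue_le ex => //; last exact: ltW.
  move=> a ea; rewrite gtr0_norm; first exact: lmax_ub.
  exact: posdefmx_eigenvalue_gt0 ea.
have aW0 : 0 < alphaW_star ximax by rewrite /alphaW_star invr_gt0 exprn_even_gt0.
have rhoE := spectral_radius_PLHSS Wsym Wpos Tsym Tunit ximaxP.
have rho_star : spectral_radius (PLHSS_mx W T (alphaW_star ximax))
    = 1 / Num.sqrt (ximax ^- 2 + 1) by rewrite rhoE// PLHSS_factor_star.
split; last first.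
  move=> x1 l1; have Dle := DI_bound_le l0 m0 x1 xlm l1.
  (* Both intervals start at 0, so comparing right endpoints suffices. *)
  split=> // a; rewrite /DI /DW /= !in_itv/= => /andP[-> aD].
  exact: lt_le_trans Dle.
split; [exact: aW0| |exact: xlm|].
  by move=> a a0; rewrite rho_star (rhoE a a0); exact: PLHSS_factor_ge.
split; [exact: rho_star| |exact: inv_sqrt_ratio|exact: sigma_alpha_star].
have s0 (y : R) : 0 < Num.sqrt (y ^+ 2 + 1).
  by rewrite sqrtr_gt0 ltr_wpDl ?sqr_ge0.
(* Undoing reciprocals, roots and squares leaves [mumin / lmax <= |ximax^-1|], the inverse of
   [xlm]. *)
rewrite -exprVn -expr_div_n !div1r lef_pV2 ?posrE// ler_wsqrtr// lerD2r.
rewrite -[leRHS]real_normK ?num_real// lerXn2r ?nnegrE ?divr_ge0 ?(ltW l0) ?(ltW m0)//.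
by rewrite normfV -[mumin / lmax]invrK lef_pV2 ?posrE ?normr_gt0 ?invf_div ?divr_gt0.
Qed.
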